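(* Let $a,b\in\mathbb{Z}$ be such that $f(x)=x^5+ax+b$ is irreducible in $\mathbb{Z}[x]$, and let $\theta$ be a root of $f$. Suppose that $\dfrac{2^8a^5+5^5b^4}{\gcd(2^8a^5,\,5^5b^4)}$ is square-free. Then $\mathbb{Z}[\theta]$ is the full ring of integers of $\mathbb{Q}(\theta)$ if and only if for each prime $p$ dividing $\gcd(2a,5b)$ one of the following conditions holds: (1) $p\mid a$ and $p\mid b$, but $p^2\nmid b$; (2) $p=2$, $2\nmid a$, and $a+b\equiv 1\pmod 4$; (3) $p=5$, $5\nmid b$, and $b\not\equiv 1+a,\ 7+2a,\ 18+3a,\ 24+4a \pmod{25}$. *)

(* Defs.v *)
From HB Require Import structures.
From mathcomp Require Import all_boot all_order all_algebra all_field.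
Set Implicit Arguments. Unset Strict Implicit. Unset Printing Implicit Defensive.
Import Order.TTheory GRing.Theory Num.Theory.
Local Open Scope ring_scope.

Definition quintic (a b : int) : {poly int} := 'X^5 + a%:P * 'X + b%:P.

Definition irreducible_in_Zx (f : {poly int}) : Prop :=
  [/\ f != 0, f \isn't a GRing.unit &
      forall g h : {poly int}, f = g * h ->
        g \is a GRing.unit \/ h \is a GRing.unit].

Definition squarefree (n : nat) : Prop :=
  (0 < n)%N /\ forall p : nat, prime p -> ~~ (p * p %| n)%N.

Definition in_Ztheta (theta x : algC) : Prop :=
  exists q : {poly int}, x = (map_poly intr q).[theta].
Definition in_Qtheta (theta x : algC) : Prop :=
  exists q : {poly rat}, x = (map_poly ratr q).[theta].

Definition Ztheta_is_ring_of_integers (theta : algC) : Prop :=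
  forall x : algC, in_Ztheta theta x <-> (in_Qtheta theta x /\ x \in Aint).

Definition cond_at (a b : int) (p : nat) : Prop :=
  [/\ (p%:Z %| a)%Z, (p%:Z %| b)%Z & ~~ ((p ^ 2)%N%:Z %| b)%Z]
  \/ [/\ p = 2%N, ~~ (2 %| a)%Z & (a + b = 1 %[mod 4])%Z]
  \/ [/\ p = 5%N, ~~ (5 %| b)%Z &
        forall k : int, k \in [:: 1 + a; 7 + 2 * a; 18 + 3 * a; 24 + 4 * a] ->
          (b != k %[mod 25])%Z].

(* Main.v *)
(**
  Fix a prime [p] and write [F] for the reduction of [f] modulo [p].  By
  Dedekind's criterion [Z[theta]] fails to be maximal at [p] exactly when
  [f = g h + p r] with [g] non-constant modulo [p] and dividing both [h] and
  [r] modulo [p].  Given such a decomposition, [h(theta) / p] is a root of a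
  monic quadratic polynomial over [Z[theta]], and it is not in [Z[theta]]
  because [F] does not divide [h] modulo [p].  Conversely, if [q(theta) / p] is
  integral then [F] divides a power of [q] modulo [p]; when it does not divide
  [q] it has a repeated factor [g], say [f = g h + p r], such that
  [z = h(theta) / p] is integral.  Now [g(theta) z = - r(theta)], and
  homogenising an integral equation of [z] shows that [g] divides a power of [r]
  modulo [p], so that [gcd(g, r)] can replace [g].

  When every repeated factor of [F] has a root, the criterion says that [f] has
  no singular point modulo [p]: no [c] with [p^2 | f(c)] and [p | f'(c)].  This
  is the case for [f = x^5 + a x + b], since [5 f - x f' = 4 a x + 5 b], and
  since [F] or [F'] is a power of a linear polynomial when [p] divides both
  [4 a] and [5 b].  Whether [c] is singular only depends on [c] modulo [p],
  which gives the conditions at the divisors of [gcd(2a, 5b)].  At any other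
  prime a singular [c] would force [p^2] to divide the discriminant
  [2^8 a^5 + 5^5 b^4], which lies in the ideal generated by [f(c)] and
  [f'(c)^2], hence also its square-free quotient.
*)
Require Import Defs.
From HB Require Import structures.
From mathcomp Require Import all_boot all_order all_algebra all_field.
From mathcomp Require Import ring zify.
Set Implicit Arguments. Unset Strict Implicit. Unset Printing Implicit Defensive.
Import Order.TTheory GRing.Theory Num.Theory.
Local Open Scope ring_scope.

(** * Arithmetic and polynomials over fields *)

Lemma prime_dvdzM (p : nat) (m n : int) : prime p ->
  (p%:Z %| m * n)%Z = (p%:Z %| m)%Z || (p%:Z %| n)%Z.
Proof. by move=> p_pr; rewrite !dvdzE abszM Euclid_dvdM. Qed.

Lemma prime_dvdzX (p : nat) (m : int) (n : nat) : prime p ->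
  (p%:Z %| m ^+ n)%Z = (0 < n)%N && (p%:Z %| m)%Z.
Proof. by move=> p_pr; rewrite !dvdzE abszX /= Euclid_dvdX // andbC. Qed.

Lemma squarefree_add_div_gcdz (u v : int) (p : nat) :
    squarefree `|((u + v) %/ gcdz u v)%Z|%N -> prime p ->
    ~~ (p%:Z %| gcdz u v)%Z ->
  ~~ ((p ^ 2)%N%:Z %| u + v)%Z.
Proof.
move=> [_ sqf] p_pr pNg; apply: contra (sqf p p_pr).
have g_uv : (gcdz u v %| u + v)%Z by rewrite rpredD ?dvdz_gcdl ?dvdz_gcdr.
rewrite dvdzE /= -[in X in X -> _](divzK g_uv) abszM Gauss_dvdl // coprimeXl //.
by rewrite prime_coprime.
Qed.

Lemma monicXnaddMXaddC (R : nzRingType) (n : nat) (u v : R) : (1 < n)%N ->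
  'X^n + (u%:P * 'X + v%:P) \is monic.
Proof.
move=> n_gt1; rewrite monicE lead_coefDl ?lead_coefXn // size_polyXn ltnS.
rewrite size_MXaddC; case: ifP => // _; apply: leq_trans n_gt1.
by rewrite ltnS size_polyC_leq1.
Qed.

Lemma coprimep_dvdp_exp (F : fieldType) (n : nat) (P Q : {poly F}) :
  coprimep P Q -> P %| Q ^+ n -> size P = 1%N.
Proof.
move=> /(coprimep_expr n) cPQ PQ; apply/eqP.
by rewrite -coprimepp (coprimep_dvdl PQ cPQ).
Qed.

Lemma dvdp_sqr_deriv (F : fieldType) (P Q : {poly F}) :
  P ^+ 2 %| Q -> P %| Q^`().
Proof.
case/dvdpP=> R ->; rewrite expr2 !derivM.
by rewrite dvdp_add ?dvdp_mull ?dvdp_add ?dvdp_mulIl ?dvdp_mulIr.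
Qed.

Lemma dvdp_exp_repeated_factor (F : fieldType) (n : nat) (P Q : {poly F}) :
    P %| Q ^+ n -> ~~ (P %| Q) ->
  exists G K, [/\ P = G * K, size G != 1%N, G %| K & gcdp Q P %| K].
Proof.
move=> P_Qn PNQ; set D := gcdp Q P; set H := P %/ D.
have defP : P = H * D by rewrite divpK ?dvdp_gcdr.
pose G := gcdp H D; have defH : H = H %/ G * G by rewrite divpK ?dvdp_gcdl.
exists G, (H %/ G * D); split; last exact: dvdp_mull.
- by rewrite defP {1}defH; ring.
- apply: contra PNQ => cHD.
  have cHQ : coprimep H Q.
    rewrite coprimep_def -coprimepp; apply: coprimep_dvdr (dvdp_gcdl _ _) _.
    apply: coprimep_dvdl _ cHD; rewrite dvdp_gcd dvdp_gcdr.
    by rewrite (dvdp_trans (dvdp_gcdl _ _)) // [X in _ %| X]defP dvdp_mulr.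
  have /eqP/size_poly1P[z z0 defHz] : size H = 1%N.
    apply: coprimep_dvdp_exp cHQ (dvdp_trans _ P_Qn).
    by rewrite [X in _ %| X]defP dvdp_mulr.
  by rewrite defP defHz mul_polyC dvdpZl // dvdp_gcdl.
- by rewrite dvdp_mull ?dvdp_gcdr.
Qed.

Lemma root_dvdp_exp_XsubC (F : fieldType) (n : nat) (z : F) (P : {poly F}) :
  (1 < size P)%N -> P %| ('X - z%:P) ^+ n -> root P z.
Proof.
move=> size_P P_Xz; apply: contraLR size_P; rewrite -coprimep_XsubC => cPX.
by rewrite (coprimep_dvdp_exp cPX P_Xz).
Qed.

Lemma root_dvdp_linear (F : fieldType) (u v : F) (P : {poly F}) :
    (1 < size P)%N -> P %| u *: 'X + v%:P -> (u != 0) || (v != 0) ->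
  root P (- v / u).
Proof.
move=> size_P P_lin; have [u0|u0 _] := eqVneq u 0.
  move=> /= v0; move: P_lin; rewrite u0 scale0r add0r => /dvdp_leq.
  by rewrite polyC_eq0 size_polyC v0 leqNgt size_P => /(_ isT).
apply: (@root_dvdp_exp_XsubC F 1) => //.
rewrite expr1 -(dvdpZr _ _ u0) scalerBr -[_ *: _%:P]mul_polyC -polyCM.
by rewrite mulrC divfK // polyCN opprK.
Qed.

Lemma gcdp_dvdp_Bezout (F : fieldType) (P Q R : {poly F}) :
  gcdp P Q %| R -> exists U V, R = U * P + V * Q.
Proof.
have [[U V] /eqp_dvdl <- /dvdpP[S ->]] := Bezoutp P Q.
by exists (S * U), (S * V); rewrite mulrDr !mulrA.
Qed.

Lemma poly_taylor_order2 (R : comNzRingType) (f : {poly R}) (c : R) :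
  exists k, f = ('X - c%:P) * (('X - c%:P) * k + f^`().[c]%:P) + f.[c]%:P.
Proof.
have quot (g : {poly R}) : exists h, g = ('X - c%:P) * h + g.[c]%:P.
  have /factor_theorem[h hE] : root (g - g.[c]%:P) c.
    by rewrite rootE !hornerE subrr.
  by exists h; rewrite mulrC -hE subrK.
have [h hE] := quot f; have [k kE] := quot h.
have -> : f^`().[c] = h.[c] by rewrite {1}hE !derivE !hornerE subrr; ring.
by exists k; rewrite -kE.
Qed.

(** * Reduction modulo a prime *)

Local Notation redp p := (map_poly (intr : int -> 'F_p)).

Lemma intr_Fp_eq0 (p : nat) (z : int) : prime p ->
  ((z%:~R : 'F_p) == 0) = (p%:Z %| z)%Z.
Proof. by move=> p_pr; rewrite (dvdz_pcharf (pchar_Fp p_pr)). Qed.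

Lemma polyFp_natr_p (p : nat) : prime p -> p%:R = 0 :> {poly 'F_p}.
Proof. by move=> p_pr; rewrite -polyC_natr pchar_Fp_0. Qed.

Lemma redp_surj (p : nat) (P : {poly 'F_p}) :
  exists Q : {poly int}, redp p Q = P.
Proof.
exists (map_poly (fun z : 'F_p => (z : nat)%:Z) P).
by rewrite map_polyK // => z; rewrite -pmulrn natr_Zp.
Qed.

Lemma redp_eq (p : nat) (P Q : {poly int}) : prime p ->
  redp p P = redp p Q -> exists R, P = Q + p%:R * R.
Proof.
move=> p_pr PQ; have /polyOver_dvdzP[R defR] : P - Q \is a polyOver (dvdz p%:Z).
  apply/polyOverP=> i; rewrite -intr_Fp_eq0 // -coef_map.
  by rewrite rmorphB /= PQ subrr coef0.
by exists R; rewrite -polyC_natr natz mul_polyC -defR addrC subrK.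
Qed.

Lemma redp_addpM (p : nat) (P Q : {poly int}) : prime p ->
  redp p (P + p%:R * Q) = redp p P.
Proof.
move=> p_pr; rewrite rmorphD rmorphM rmorph_nat /=.
by rewrite polyFp_natr_p // mul0r addr0.
Qed.

Lemma XaddC_Fp_exp (p n : nat) (c : 'F_p) : prime p -> p.-nat n ->
  ('X + c%:P) ^+ n = 'X^n + c%:P.
Proof.
move=> p_pr p_n.
have pP : p \in [pchar {poly 'F_p}] by rewrite pchar_poly pchar_Fp.
rewrite exprDn_pchar ?(eq_pnat _ (pcharf_eq pP)) //; congr (_ + _).
have [k ->] := p_natP p_n; elim: k => [|k IHk]; first by rewrite expr1.
rewrite expnSr exprM IHk -polyC_exp -[in X in _ ^+ X](card_Fp p_pr).
by rewrite expf_card.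
Qed.

Lemma root_dvdp_XnaddC_Fp (p n : nat) (c : 'F_p) (P : {poly 'F_p}) :
  prime p -> p.-nat n -> (1 < size P)%N -> P %| 'X^n + c%:P -> root P (- c).
Proof.
move=> p_pr p_n size_P P_Xc; apply: (@root_dvdp_exp_XsubC _ n) => //.
by rewrite polyCN opprK XaddC_Fp_exp.
Qed.

(** * Algebraic integers *)

Definition evalZ (x : algC) (P : {poly int}) : algC := (map_poly intr P).[x].

HB.instance Definition _ (x : algC) :=
  GRing.RMorphism.copy (evalZ x) (horner_eval x \o map_poly intr).

Lemma evalZC (x : algC) (c : int) : evalZ x c%:P = c%:~R.
Proof. by rewrite /evalZ map_polyC hornerC. Qed.

Lemma evalZ_Aint (x : algC) (P : {poly int}) : x \in Aint -> evalZ x P \in Aint.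
Proof.
move=> xA; rewrite /evalZ horner_coef; apply: rpred_sum => i _.
by rewrite coef_map rpredM ?rpredX ?Aint_int.
Qed.

Lemma size_map_poly_intr (R : numDomainType) (P : {poly int}) :
  size (map_poly intr P : {poly R}) = size P.
Proof. by rewrite size_map_inj_poly //; exact: intr_inj. Qed.

Lemma map_poly_ratr_int (R : numFieldType) (P : {poly int}) :
  map_poly ratr (map_poly intr P : {poly rat}) = map_poly intr P :> {poly R}.
Proof.
by rewrite -map_poly_comp; apply: eq_map_poly => z /=; rewrite ratr_int.
Qed.

Lemma minCpoly_int_monic (f : {poly int}) (x : algC) :
  minCpoly x = map_poly intr f -> f \is monic.
Proof.
move=> min_f; have := minCpoly_monic x.
rewrite min_f !monicE lead_coef_map_inj ?(eqr_int _ _ 1) //; exact: intr_inj.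
Qed.

Lemma minCpoly_int_Aint (f : {poly int}) (x : algC) :
  minCpoly x = map_poly intr f -> x \in Aint.
Proof.
by rewrite unfold_in => ->; apply/polyOverP=> i; rewrite coef_map intr_int.
Qed.

Lemma Aint_integralOver (x : algC) :
  x \in Aint <-> integralOver (intr : int -> algC) x.
Proof.
split=> [/floorpP[P defP]|[P monP Px]].
  exists P; [exact: minCpoly_int_monic defP | by rewrite -defP root_minCpoly].
apply: root_monic_Aint Px _ _; first exact: monic_map.
by apply/polyOverP=> i; rewrite coef_map intr_int.
Qed.

Lemma Aint_root_monic (P : {poly algC}) (x : algC) :
  P \is monic -> P \is a polyOver Aint -> root P x -> x \in Aint.
Proof.
move=> monP /polyOverP PA Px.
apply/Aint_integralOver/(integral_root_monic monP Px).
by apply/integral_poly=> i; apply/Aint_integralOver.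
Qed.

Lemma Aint_quadratic (u v x : algC) :
  u \in Aint -> v \in Aint -> x ^+ 2 = u * x + v -> x \in Aint.
Proof.
move=> uA vA def_x2.
apply: (@Aint_root_monic ('X^2 + ((- u)%:P * 'X + (- v)%:P))).
- exact: monicXnaddMXaddC.
- by rewrite ?(rpredD, rpredM) ?polyOverXn ?polyOverX ?polyOverC ?rpredN.
- by rewrite rootE !hornerE /= def_x2; apply/eqP; ring.
Qed.

(* Multiply an integral equation of [y] by a power of [A(x)]. *)
Lemma Aint_quotient_exp (x y : algC) (A B : {poly int}) :
    y \in Aint -> evalZ x A * y = evalZ x B ->
  exists n C, evalZ x (B ^+ n) = evalZ x (A * C).
Proof.
move=> /Aint_integralOver[P monP /rootP Py] defB.
have [n sizeP] : exists n, size P = n.+1.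
  by exists (size P).-1; rewrite prednK ?size_poly_gt0 ?monic_neq0.
exists n, (- \sum_(i < n) P`_i *: (B ^+ i * A ^+ (n.-1 - i))).
apply/eqP; rewrite -subr_eq0 rmorphM rmorphN mulrN opprK; apply/eqP.
transitivity (evalZ x A ^+ n * (map_poly intr P).[y]); last by rewrite Py mulr0.
rewrite horner_coef size_map_poly_intr sizeP big_ord_recr /= mulrDr addrC.
rewrite !coef_map /=.
have -> : P`_n = 1 by move: monP; rewrite monicE lead_coefE sizeP => /eqP.
rewrite mul1r -exprMn defB rmorphXn /= rmorph_sum !mulr_sumr; congr (_ + _).
apply: eq_bigr => i _; rewrite coef_map -mul_polyC !rmorphM !rmorphXn /= -defB.
rewrite evalZC exprMn.
have -> : evalZ x A ^+ n =
    evalZ x A ^+ i * evalZ x A ^+ (n.-1 - i) * evalZ x A.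
  by rewrite -exprD -exprSr; congr (_ ^+ _); have := ltn_ord i; lia.
by ring.
Qed.

Lemma irreducible_monic_minCpoly (f : {poly int}) (x : algC) :
  irreducible_in_Zx f -> f \is monic -> evalZ x f = 0 ->
  minCpoly x = map_poly intr f.
Proof.
move=> [_ _ irr_f] monf fx; have [P [minP monP] dvdP] := minCpolyP x.
have P_f : P %| map_poly intr f.
  by rewrite -dvdP map_poly_ratr_int; apply/rootP.
have size_P : (1 < size P)%N.
  by rewrite -(size_map_poly (@ratr algC)) -minP size_minCpoly.
have [g [k k0 defP] [h deff]] := dvdpP_rat_int P_f.
have size_g : size P = size g by rewrite defP size_scale ?size_map_poly_intr.
have [|] := irr_f _ _ deff; rewrite poly_unitE => /andP[].
  by move/eqP=> size_g1; rewrite size_g size_g1 in size_P.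
move=> /size_poly1P[z z0 defh] _.
rewrite minP -map_poly_ratr_int; congr (map_poly _ _).
apply/eqP; rewrite -eqp_monic ?monic_map //.
rewrite defP deff defh mulrC mul_polyC map_polyZ /=.
apply: eqp_trans (eqp_scale _ k0) _; rewrite eqp_sym eqp_scale //.
by rewrite intr_eq0.
Qed.

Lemma evalZ_eq0 (f R : {poly int}) (theta : algC) :
    minCpoly theta = map_poly intr f ->
  evalZ theta R = 0 <-> exists E, R = f * E.
Proof.
move=> min_f; have monf := minCpoly_int_monic min_f.
have f_theta : evalZ theta f = 0 by apply/rootP; rewrite -min_f root_minCpoly.
split=> [R_theta|[E ->]]; last by rewrite rmorphM /= f_theta mul0r.
have := Pdiv.RingMonic.rdivp_eq monf R.
set E := Pdiv.CommonRing.rdivp _ _; set r := Pdiv.CommonRing.rmodp _ _ => defR.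
exists E; rewrite defR mulrC; suff -> : r = 0 by rewrite addr0.
have size_r : (size r < size f)%N.
  by rewrite Pdiv.Ring.ltn_rmodpN0 ?monic_neq0.
have r_theta : evalZ theta r = 0.
  by rewrite -R_theta defR rmorphD rmorphM /= f_theta mulr0 add0r.
have [P [minP _] dvdP] := minCpolyP theta.
apply/eqP; apply: contraTT size_r => r0; rewrite -leqNgt.
have P_r : P %| map_poly intr r.
  by rewrite -dvdP map_poly_ratr_int; apply/rootP.
have -> : size f = size P.
  by rewrite -(size_map_poly (@ratr algC)) -minP min_f size_map_poly_intr.
rewrite -(size_map_poly_intr rat r) dvdp_leq //.
by rewrite -size_poly_eq0 size_map_poly_intr size_poly_eq0.
Qed.

(** * Dedekind's criterion *)

Definition Ztheta_maximal_at (theta : algC) (p : nat) : Prop :=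
  forall y, y \in Aint -> in_Ztheta theta (p%:R * y) -> in_Ztheta theta y.

Lemma in_Ztheta_evalZ (x : algC) (P : {poly int}) : in_Ztheta x (evalZ x P).
Proof. by exists P. Qed.

Lemma in_Qtheta_evalZ_div (x : algC) (P : {poly int}) (n : nat) :
  in_Qtheta x (evalZ x P / n%:R).
Proof.
exists (n%:R^-1 *: map_poly intr P).
by rewrite map_polyZ hornerZ map_poly_ratr_int fmorphV rmorph_nat mulrC.
Qed.

Lemma in_Qtheta_clear_denominator (x y : algC) : in_Qtheta x y ->
  exists2 n, (0 < n)%N & in_Ztheta x (n%:R * y).
Proof.
case=> q ->; have [r [k k0 ->]] := rat_poly_scale q.
exists `|k|%N; first by rewrite absz_gt0.
suff -> : `|k|%N%:R * (map_poly ratr (k%:~R^-1 *: map_poly intr r)).[x] =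
    evalZ x ((sgz k)%:P * r) by exact: in_Ztheta_evalZ.
rewrite rmorphM /= evalZC map_polyZ hornerZ map_poly_ratr_int fmorphV /=.
rewrite ratr_int mulrA.
congr (_ * _); apply: (canLR (mulfK _)); first by rewrite intr_eq0.
by rewrite -intrM -abszEsg pmulrn.
Qed.

Lemma Ztheta_maximal_local (theta : algC) : theta \in Aint ->
  (Ztheta_is_ring_of_integers theta <->
   forall p, prime p -> Ztheta_maximal_at theta p).
Proof.
move=> thetaA; split=> [max p p_pr y yA [q defq]|max_at y].
  have p0 : p%:R != 0 :> algC by rewrite pnatr_eq0 -lt0n prime_gt0.
  apply/max; split=> //; rewrite -[y](mulKf p0) defq mulrC.
  exact: in_Qtheta_evalZ_div.
split=> [[q ->]|[/in_Qtheta_clear_denominator[n]]].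
  split; last exact: evalZ_Aint.
  by have := in_Qtheta_evalZ_div theta q 1; rewrite divr1.
have [m] := ubnP n; elim: m n => // m IHm n /ltnSE le_nm n0 ny yA.
have [n1|n_neq1] := eqVneq n 1; first by move: ny; rewrite n1 mul1r.
have n_gt1 : (1 < n)%N by lia.
have p_pr := pdiv_prime n_gt1; have p_gt1 := prime_gt1 p_pr.
have [d defn] := dvdnP (pdiv_dvd n).
apply: (IHm d) => //; [by nia | by nia |].
apply: (max_at _ p_pr); first by rewrite rpredM ?rpred_nat.
by rewrite mulrA -natrM mulnC -defn.
Qed.

Lemma Aint_of_linear_relations (n g y r k s v t : algC) :
    n != 0 -> k \in Aint -> s \in Aint -> v \in Aint -> t \in Aint ->
    g * y + r = 0 -> n * y = k * g + n * s -> r = v * g + n * t ->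
  y \in Aint.
Proof.
move=> n0 kA sA vA tA gy nyE rE.
apply: (@Aint_quadratic (s - v) (v * s - k * t)); rewrite ?rpredB ?rpredM //.
have {}gy : g * y = - r by apply/eqP; rewrite -addr_eq0 gy.
have kgE : k * g = n * y - n * s by rewrite nyE addrK.
apply: (mulfI n0).
transitivity ((k * g + n * s) * y); first by rewrite -nyE; ring.
transitivity (k * (g * y) + n * s * y); first by ring.
rewrite gy rE.
transitivity (- v * (k * g) - n * (k * t) + n * s * y); first by ring.
by rewrite kgE; ring.
Qed.

Section Dedekind.

Variables (f : {poly int}) (theta : algC) (p : nat).
Hypothesis min_f : minCpoly theta = map_poly intr f.
Hypothesis p_pr : prime p.

Local Notation ev := (evalZ theta).

Definition dedekind_defect : Prop :=
  exists g h r : {poly int},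
    [/\ f = g * h + p%:R * r, (1 < size (redp p g))%N,
        redp p g %| redp p h & redp p g %| redp p r].

Let natr_p_neq0 : p%:R != 0 :> algC.
Proof. by rewrite pnatr_eq0 -lt0n prime_gt0. Qed.

Let f_theta : ev f = 0.
Proof. by apply/rootP; rewrite -min_f root_minCpoly. Qed.

Let ev_Aint (P : {poly int}) : ev P \in Aint.
Proof. exact/evalZ_Aint/minCpoly_int_Aint/min_f. Qed.

Let redp_f_neq0 : redp p f != 0.
Proof. exact/monic_neq0/monic_map/minCpoly_int_monic/min_f. Qed.

Lemma dedekind_defect_Aint (g h r : {poly int}) (y : algC) :
    f = g * h + p%:R * r -> redp p g %| redp p h -> redp p g %| redp p r ->
    p%:R * y = ev h ->
  y \in Aint.
Proof.
move=> deff /dvdpP[K defh] /dvdpP[V defr] py.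
have [[k defk] [v defv]] := (redp_surj K, redp_surj V).
have [|s hE] := @redp_eq p h (k * g) p_pr; first by rewrite rmorphM /= defk.
have [|t rE] := @redp_eq p r (v * g) p_pr; first by rewrite rmorphM /= defv.
apply: (@Aint_of_linear_relations
  p%:R (ev g) y (ev r) (ev k) (ev s) (ev v) (ev t)) => //.
- apply: (mulfI natr_p_neq0); rewrite mulr0 mulrDr mulrCA py -f_theta.
  by rewrite [in RHS]deff !(rmorphD, rmorphM) rmorph_nat.
- by rewrite py [in LHS]hE !(rmorphD, rmorphM) rmorph_nat.
- by rewrite [in LHS]rE !(rmorphD, rmorphM) rmorph_nat.
Qed.

Lemma proper_cofactor_notin_Ztheta (g h : {poly int}) (y : algC) :
    redp p f = redp p g * redp p h -> (1 < size (redp p g))%N ->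
    p%:R * y = ev h ->
  ~ in_Ztheta theta y.
Proof.
move=> redp_f size_g py [q defq].
have /(evalZ_eq0 _ min_f)[E defE] : ev (h - p%:R * q) = 0.
  by rewrite rmorphB rmorphM rmorph_nat /= -py defq subrr.
have f_h : redp p f %| redp p h.
  by rewrite -(redp_addpM h (- q) p_pr) mulrN defE rmorphM dvdp_mulr.
have h0 : redp p h != 0.
  by apply: contraNneq redp_f_neq0 => h0; rewrite redp_f h0 mulr0.
have g0 : redp p g != 0 by rewrite -size_poly_gt0 ltnW.
have := dvdp_leq h0 f_h; rewrite redp_f size_mul //.
by rewrite -subn1 leq_subLR leq_add2r leqNgt size_g.
Qed.

Lemma dedekind_defect_not_maximal :
  dedekind_defect -> ~ Ztheta_maximal_at theta p.
Proof.
case=> g [h [r [deff size_g g_h g_r]]] max.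
have [y py] : exists y, p%:R * y = ev h.
  by exists (ev h / p%:R); rewrite mulrC divfK.
have yA : y \in Aint := dedekind_defect_Aint deff g_h g_r py.
apply: (proper_cofactor_notin_Ztheta _ size_g py).
  by rewrite {1}deff redp_addpM // rmorphM.
by apply: max; rewrite // py; exact: in_Ztheta_evalZ.
Qed.

Lemma in_Ztheta_of_redp_dvdp (y : algC) (q : {poly int}) :
  p%:R * y = ev q -> redp p f %| redp p q -> in_Ztheta theta y.
Proof.
move=> py /dvdpP[U defq]; have [u defu] := redp_surj U.
have [|e qE] := @redp_eq p q (u * f) p_pr; first by rewrite rmorphM /= defu.
exists e; apply: (mulfI natr_p_neq0).
by rewrite py qE rmorphD !rmorphM rmorph_nat /= f_theta mulr0 add0r.
Qed.

Lemma Aint_quotient_dvdp_exp (y : algC) (A B : {poly int}) (D : {poly 'F_p}) :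
    y \in Aint -> ev A * y = ev B -> D %| redp p f -> D %| redp p A ->
  exists n, D %| redp p B ^+ n.
Proof.
move=> yA defB D_f D_A; have [n [C /eqP]] := Aint_quotient_exp yA defB.
rewrite -subr_eq0 -rmorphB => /eqP/(evalZ_eq0 _ min_f)[E defE]; exists n.
have -> : redp p B ^+ n = redp p A * redp p C + redp p f * redp p E.
  by rewrite -!rmorphM -defE -rmorphXn -rmorphD addrC subrK.
by rewrite dvdp_add ?dvdp_mulr.
Qed.

Lemma Aint_lift_gcdp (y : algC) (q h : {poly int}) :
    y \in Aint -> p%:R * y = ev q -> gcdp (redp p q) (redp p f) %| redp p h ->
  exists2 z, z \in Aint & p%:R * z = ev h.
Proof.
move=> yA py /gcdp_dvdp_Bezout[U [V defh]].
have [[u defu] [v defv]] := (redp_surj U, redp_surj V).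
have [|e hE] := @redp_eq p h (u * q + v * f) p_pr.
  by rewrite defh rmorphD !rmorphM /= defu defv.
exists (ev u * y + ev e); first by rewrite rpredD ?rpredM.
rewrite hE !rmorphD !rmorphM rmorph_nat /= f_theta mulr0 addr0 -py; ring.
Qed.

Lemma dedekind_defect_dvdp (g h r : {poly int}) (D : {poly 'F_p}) :
    f = g * h + p%:R * r -> redp p g %| redp p h ->
    (1 < size D)%N -> D %| redp p g -> D %| redp p r ->
  dedekind_defect.
Proof.
move=> deff g_h size_D /dvdpP[W defg] D_r.
have [[d defd] [w defw]] := (redp_surj D, redp_surj W).
have [|e gE] := @redp_eq p g (d * w) p_pr.
  by rewrite rmorphM /= defd defw mulrC.
exists d, (w * h), (e * h + r); rewrite defd; split=> //.
- by rewrite deff gE; ring.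
- by rewrite rmorphM dvdp_mull // (dvdp_trans _ g_h) // defg dvdp_mull.
rewrite rmorphD rmorphM dvdp_add ?dvdp_mull //= (dvdp_trans _ g_h) //.
by rewrite defg dvdp_mull.
Qed.

Lemma maximal_of_no_dedekind_defect :
  ~ dedekind_defect -> Ztheta_maximal_at theta p.
Proof.
move=> no_defect y yA [q py]; have [|fNq] := boolP (redp p f %| redp p q).
  exact: in_Ztheta_of_redp_dvdp.
have [n f_qn] : exists n, redp p f %| redp p q ^+ n.
  apply: (@Aint_quotient_dvdp_exp y p%:R); rewrite ?rmorph_nat //.
  by rewrite polyFp_natr_p ?dvdp0.
have [G [K [defF size_G G_K gcd_K]]] := dvdp_exp_repeated_factor f_qn fNq.
have [[g defg] [h defh]] := (redp_surj G, redp_surj K); subst G K.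
have [|r deff] := @redp_eq p f (g * h) p_pr; first by rewrite rmorphM.
have [z zA pz] := Aint_lift_gcdp yA py gcd_K.
have [m g_rm] : exists m, redp p g %| redp p r ^+ m.
  apply: (@Aint_quotient_dvdp_exp z (- g)) => //.
  - apply: (mulfI natr_p_neq0); rewrite mulrCA pz rmorphN mulNr; apply/eqP.
    rewrite eq_sym -addr_eq0 addrC -f_theta deff !(rmorphD, rmorphM).
    by rewrite rmorph_nat.
  - by rewrite defF dvdp_mulr.
  - by rewrite rmorphN dvdpNr.
case: no_defect.
apply: (dedekind_defect_dvdp deff G_K _ (dvdp_gcdl _ (redp p r)));
  last exact: dvdp_gcdr.
have g0 : redp p g != 0.
  by apply: contraNneq redp_f_neq0 => g0; rewrite defF g0 mul0r.
rewrite ltn_neqAle eq_sym size_poly_gt0 gcdp_eq0 (negPf g0) andbT.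
by apply: contra size_G => c_gr; apply/eqP/(coprimep_dvdp_exp c_gr g_rm).
Qed.

Theorem dedekind_criterion : Ztheta_maximal_at theta p <-> ~ dedekind_defect.
Proof.
split=> [max defect|]; first exact: dedekind_defect_not_maximal defect max.
exact: maximal_of_no_dedekind_defect.
Qed.

End Dedekind.

(** * Singular points modulo a prime *)

Definition singular_at (f : {poly int}) (p : nat) (c : int) : bool :=
  ((p ^ 2)%N%:Z %| f.[c])%Z && (p%:Z %| f^`().[c])%Z.

Definition nonsingular_mod (f : {poly int}) (p : nat) : Prop :=
  forall c, ~~ singular_at f p c.

Lemma singular_at_congr (f : {poly int}) (p : nat) (c d : int) :
  (p%:Z %| d - c)%Z -> singular_at f p c -> singular_at f p d.
Proof.
move=> /dvdzP[u cd] /andP[/dvdzP[s fc] /dvdzP[t f'c]].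
have [k ->] := poly_taylor_order2 f c.
rewrite /singular_at fc f'c expnS expn1 PoszM !derivE !hornerE /= cd.
apply/andP; split; apply/dvdzP.
  by exists (u * (u * k.[d] + t) + s); ring.
by exists (u * k.[d] + t + u * k.[d] + u * (u * p%:Z * k^`().[d])); ring.
Qed.

Lemma nonsingular_mod_residues (f : {poly int}) (p : nat) : (0 < p)%N ->
  nonsingular_mod f p <->
  (forall r : nat, (r < p)%N -> ~~ singular_at f p (- r%:Z)).
Proof.
move=> p0; split=> [nonsing r _|nonsing c]; first exact: nonsing.
pose r := `|((- c) %% p%:Z)%Z|%N.
have rE : r%:Z = ((- c) %% p%:Z)%Z by rewrite gez0_abs ?modz_ge0 -?lt0n.
have r_p : (r < p)%N by rewrite -ltz_nat rE ltz_pmod.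
apply: contra (nonsing r r_p); apply: singular_at_congr; apply/dvdzP.
by exists ((- c) %/ p%:Z)%Z; apply/eqP; rewrite rE addrC subr_eq -divz_eq.
Qed.

Lemma singular_at_dedekind_defect (f : {poly int}) (p : nat) (c : int) :
  prime p -> singular_at f p c -> dedekind_defect f p.
Proof.
move=> p_pr /andP[/dvdzP[s fc] /dvdzP[t f'c]].
have [k defk] := poly_taylor_order2 f c.
exists ('X - c%:P), (('X - c%:P) * k + p%:R * t%:P), (p%:R * s%:P); split.
- rewrite {1}defk fc f'c expnS expn1 PoszM !polyCM -natz polyC_natr; ring.
- by rewrite rmorphB /= map_polyX map_polyC size_XsubC.
- by rewrite redp_addpM // rmorphM dvdp_mulr.
- by rewrite rmorphM rmorph_nat polyFp_natr_p // mul0r dvdp0.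
Qed.

Lemma root_dedekind_defect_singular_at
    (g h r : {poly int}) (p : nat) (c : int) :
    prime p -> redp p g %| redp p h -> redp p g %| redp p r ->
    root (redp p g) c%:~R ->
  singular_at (g * h + p%:R * r) p c.
Proof.
move=> p_pr g_h g_r gc.
have dvd_at P : redp p g %| redp p P -> exists q, P.[c] = q * p%:Z.
  move=> g_P; apply/dvdzP; rewrite -intr_Fp_eq0 // -horner_map /= -rootE.
  exact: root_dvdp g_P gc.
have [[s gcE] [t hcE]] := (dvd_at g (dvdpp _), dvd_at h g_h).
have [u rcE] := dvd_at r g_r.
rewrite /singular_at -polyC_natr natz !derivE !hornerE /= gcE hcE rcE.
rewrite expnS expn1 PoszM; apply/andP; split; apply/dvdzP.
  by exists (s * t + u); ring.
by exists (g^`().[c] * t + s * h^`().[c] + r^`().[c]); ring.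
Qed.

Lemma Ztheta_maximal_at_nonsingular (f : {poly int}) (theta : algC) (p : nat) :
    minCpoly theta = map_poly intr f -> prime p ->
    (forall P : {poly 'F_p}, (1 < size P)%N -> P ^+ 2 %| redp p f ->
       exists z, root P z) ->
  Ztheta_maximal_at theta p <-> nonsingular_mod f p.
Proof.
move=> min_f p_pr has_root; apply: iff_trans (dedekind_criterion min_f p_pr) _.
split=> [no_defect c|nonsing [g [h [r [deff size_g g_h g_r]]]]].
  by apply/negP=> /(singular_at_dedekind_defect p_pr).
have [|z gz] := has_root _ size_g.
  by rewrite deff redp_addpM // rmorphM expr2 dvdp_mul.
have /negP[] := nonsing (z : nat)%:Z; rewrite deff.
by apply: root_dedekind_defect_singular_at; rewrite // -pmulrn natr_Zp.
Qed.

(** * The quintic trinomial *)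

Lemma quintic_monic (a b : int) : quintic a b \is monic.
Proof. by rewrite /quintic -addrA monicXnaddMXaddC. Qed.

Lemma quintic_singularE (a b : int) (p : nat) (c : int) :
  singular_at (quintic a b) p c =
  ((p ^ 2)%N%:Z %| c ^+ 5 + a * c + b)%Z && (p%:Z %| 5 * c ^+ 4 + a)%Z.
Proof.
rewrite /singular_at /quintic !derivE !hornerE /=; congr (_ && (_ %| _)%Z).
by ring.
Qed.

Lemma redp_quintic (p : nat) (a b : int) :
  redp p (quintic a b) = 'X^5 + (a%:~R)%:P * 'X + (b%:~R)%:P.
Proof.
by rewrite /quintic !rmorphD rmorphM /= map_polyXn !map_polyC map_polyX.
Qed.

Lemma deriv_redp_quintic (p : nat) (a b : int) :
  (redp p (quintic a b))^`() = 5%:P * 'X^4 + (a%:~R)%:P.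
Proof. by rewrite redp_quintic !derivE /= polyC_natr; ring. Qed.

Lemma quintic_multiple_factor_root (a b : int) (p : nat) (P : {poly 'F_p}) :
    prime p -> (1 < size P)%N -> P ^+ 2 %| redp p (quintic a b) ->
  exists z, root P z.
Proof.
move=> p_pr size_P; set F := redp p _ => P2_F.
have P_F : P %| F by apply: dvdp_trans P2_F; rewrite dvdp_exp.
have P_F' : P %| F^`() by exact: dvdp_sqr_deriv.
have P_lin : P %| (4 * a%:~R) *: 'X + (5 * b%:~R)%:P.
  have -> : (4 * a%:~R) *: 'X + (5 * b%:~R)%:P = 5%:P * F - 'X * F^`().
    rewrite /F deriv_redp_quintic redp_quintic -mul_polyC !polyCM !polyC_natr.
    by ring.
  by rewrite dvdp_sub ?dvdp_mull.
have [ab0|] := boolP ((4 * a%:~R != 0 :> 'F_p) || (5 * b%:~R != 0 :> 'F_p)).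
  by eexists; exact: root_dvdp_linear P_lin ab0.
rewrite negb_or !negbK !mulf_eq0 => /andP[a4 b5].
move: P_F P_F'; rewrite /F deriv_redp_quintic redp_quintic.
have [a0 P_F _|a0 _ P_F'] := eqVneq (a%:~R : 'F_p) 0; last first.
  move: a4; rewrite (negPf a0) orbF => four0.
  have p2 : p = 2%N.
    move: four0; rewrite -(dvdn_pcharf (pchar_Fp p_pr)) (@Euclid_dvdM 2 2) //.
    by rewrite orbb dvdn_prime2 // => /eqP.
  have five1 : 5 = 1 :> 'F_p by rewrite -[5]/(1 + 4) (eqP four0) addr0.
  exists (- a%:~R); apply: (@root_dvdp_XnaddC_Fp p 4); rewrite ?p2 //.
  by move: P_F'; rewrite five1 mul1r.
move: P_F; rewrite a0 mul0r addr0 => P_F.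
have [b0|b0] := eqVneq (b%:~R : 'F_p) 0.
  exists 0; apply: (@root_dvdp_exp_XsubC _ 5) => //.
  by move: P_F; rewrite b0 addr0 subr0.
have p5 : p = 5%N.
  move: b5; rewrite (negPf b0) orbF -(dvdn_pcharf (pchar_Fp p_pr)).
  by rewrite dvdn_prime2 // => /eqP.
by exists (- b%:~R); apply: (@root_dvdp_XnaddC_Fp p 5); rewrite ?p5.
Qed.

(* With [A = f'(c)] the second summand is
   [2^8 a^5 + 5^5 c^4 (c^4 + a)^4 = 2^8 a^5 + (A - a) (A + 4 a)^4],
   whose constant and linear terms in [A] vanish. *)
Lemma quintic_disc_Bezout (R : comPzRingType) (a b c : R) :
    2 ^+ 8 * a ^+ 5 + 5 ^+ 5 * b ^+ 4 =
  5 ^+ 5 * (b - c * (c ^+ 4 + a)) * (b ^+ 2 + (c * (c ^+ 4 + a)) ^+ 2)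
    * (c ^+ 5 + a * c + b)
  + ((5 * c ^+ 4 + a) ^+ 3 + 15 * (5 * c ^+ 4 + a) ^+ 2 * a
     + 80 * (5 * c ^+ 4 + a) * a ^+ 2 + 160 * a ^+ 3) * (5 * c ^+ 4 + a) ^+ 2.
Proof. ring. Qed.

Lemma quintic_singular_dvd_disc (a b c : int) (p : nat) :
  singular_at (quintic a b) p c ->
  ((p ^ 2)%N%:Z %| 2 ^+ 8 * a ^+ 5 + 5 ^+ 5 * b ^+ 4)%Z.
Proof.
rewrite quintic_singularE (quintic_disc_Bezout a b c) => /andP[p2_f p_f'].
apply: rpredD; first exact: dvdz_mull.
by rewrite dvdz_mull // expnS expn1 PoszM expr2 dvdz_mul.
Qed.

Lemma quintic_nonsingular_dvd (a b : int) (p : nat) :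
    prime p -> (p%:Z %| a)%Z -> (p%:Z %| b)%Z ->
  nonsingular_mod (quintic a b) p <-> ~~ ((p ^ 2)%N%:Z %| b)%Z.
Proof.
move=> p_pr pa pb; split=> [/(_ 0)|p2b c].
  by rewrite quintic_singularE !expr0n /= !mulr0 !add0r pa andbT.
rewrite quintic_singularE; apply: contra p2b => /andP[p2f _].
have p2E : (p ^ 2)%N%:Z = p%:Z * p%:Z by rewrite expnS expn1 PoszM.
have pc : (p%:Z %| c)%Z.
  have : (p%:Z %| c ^+ 5 + a * c + b)%Z.
    by apply: dvdz_trans p2f; rewrite p2E dvdz_mulr.
  by rewrite -addrA rpredDr ?prime_dvdzX // rpredD ?dvdz_mulr.
have p2_c : ((p ^ 2)%N%:Z %| c ^+ 5 + a * c)%Z.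
  rewrite p2E; apply: rpredD; last exact: dvdz_mul.
  by rewrite 2!exprS mulrA dvdz_mulr ?dvdz_mul.
by move: p2f; rewrite rpredDl.
Qed.

Lemma quintic_nonsingular_2 (a b : int) : ~~ (2 %| a)%Z -> (2 %| b)%Z ->
  nonsingular_mod (quintic a b) 2 <-> (a + b = 1 %[mod 4])%Z.
Proof.
move=> a2 b2.
have singN1 : singular_at (quintic a b) 2 (- 1) = (4 %| b - a - 1)%Z.
  rewrite quintic_singularE -[(- 1) ^+ 5]/(- 1 : int) -[(- 1) ^+ 4]/(1 : int).
  by lia.
split=> [/(_ (- 1))|ab]; first by rewrite singN1; lia.
apply/nonsingular_mod_residues=> // -[|[|//]] _; last by rewrite singN1; lia.
by rewrite quintic_singularE oppr0 expr0n /=; lia.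
Qed.

Lemma quintic_nonsingular_5 (a b : int) : (5 %| a)%Z -> ~~ (5 %| b)%Z ->
  nonsingular_mod (quintic a b) 5 <->
  (forall k : int, k \in [:: 1 + a; 7 + 2 * a; 18 + 3 * a; 24 + 4 * a] ->
     (b != k %[mod 25])%Z).
Proof.
move=> a5 b5.
have singE (r : nat) : singular_at (quintic a b) 5 (- r%:Z) =
    (b == r%:Z ^+ 5 + r%:Z * a %[mod 25])%Z.
  rewrite quintic_singularE andb_idr => [|_]; last first.
    by rewrite rpredDr // dvdz_mulr.
  rewrite eqz_mod_dvd; congr (_ %| _)%Z; ring.
split=> [nonsing k|cong].
  rewrite !inE => /or4P[] /eqP->.
  - by apply: contra (nonsing (- 1%:Z)); rewrite singE; lia.
  - by apply: contra (nonsing (- 2%:Z)); rewrite singE; lia.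
  - by apply: contra (nonsing (- 3%:Z)); rewrite singE; lia.
  - by apply: contra (nonsing (- 4%:Z)); rewrite singE; lia.
have [k1 k2 k3 k4] : [/\ (b != 1 + a %[mod 25])%Z, (b != 7 + 2 * a %[mod 25])%Z,
    (b != 18 + 3 * a %[mod 25])%Z & (b != 24 + 4 * a %[mod 25])%Z].
  by split; apply: cong; rewrite !inE eqxx ?orbT.
by apply/nonsingular_mod_residues=> // -[|[|[|[|[|//]]]]] _; rewrite singE; lia.
Qed.

Lemma prime_dvd_gcdz_2a_5b (a b : int) (p : nat) :
    prime p -> (p%:Z %| gcdz (2 * a) (5 * b))%Z ->
  [\/ (p%:Z %| a)%Z /\ (p%:Z %| b)%Z,
      [/\ p = 2%N, ~~ (2 %| a)%Z & (2 %| b)%Z] |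
      [/\ p = 5%N, (5 %| a)%Z & ~~ (5 %| b)%Z]].
Proof.
move=> p_pr; rewrite dvdz_gcd !prime_dvdzM // => /andP[p2a p5b].
have dvd_prime (q : nat) : prime q -> (p%:Z %| q%:Z)%Z -> p = q.
  by move=> q_pr; rewrite dvdzE /= dvdn_prime2 // => /eqP.
have [pa|pa] := boolP (p%:Z %| a)%Z; have [pb|pb] := boolP (p%:Z %| b)%Z.
- by constructor 1.
- move: p5b; rewrite (negPf pb) orbF => /(dvd_prime 5 isT) p5; subst p.
  by constructor 3.
- move: p2a; rewrite (negPf pa) orbF => /(dvd_prime 2 isT) p2; subst p.
  by constructor 2.
by move: p2a p5b; rewrite (negPf pa) (negPf pb) !orbF => /(dvd_prime 2 isT) ->.
Qed.

Lemma quintic_nonsingular_cond_at (a b : int) (p : nat) :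
    prime p -> (p%:Z %| gcdz (2 * a) (5 * b))%Z ->
  nonsingular_mod (quintic a b) p <-> cond_at a b p.
Proof.
move=> p_pr /(prime_dvd_gcdz_2a_5b p_pr)[[pa pb]|[p2 a2 b2]|[p5 a5 b5]].
- apply: (iff_trans (quintic_nonsingular_dvd p_pr pa pb)).
  split=> [p2b|[[]|[[p2 /negP[]]|[p5 /negP[]]]]] //; by [left | subst p].
- subst p; apply: (iff_trans (quintic_nonsingular_2 a2 b2)).
  split=> [ab|[[]|[[]|[]]]] //; first by right; left.
  by move=> a_even; rewrite a_even in a2.
subst p; apply: (iff_trans (quintic_nonsingular_5 a5 b5)).
split=> [cong|[[_ five_b]|[[]|[]]]] //; first by right; right.
by rewrite five_b in b5.
Qed.

Lemma quintic_nonsingular_disc_squarefree (a b : int) (p : nat) :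
    squarefree `|((2 ^+ 8 * a ^+ 5 + 5 ^+ 5 * b ^+ 4)
                 %/ gcdz (2 ^+ 8 * a ^+ 5) (5 ^+ 5 * b ^+ 4))%Z|%N ->
    prime p -> ~~ (p%:Z %| gcdz (2 * a) (5 * b))%Z ->
  nonsingular_mod (quintic a b) p.
Proof.
move=> sqf p_pr pNg c; apply: contra (squarefree_add_div_gcdz sqf p_pr _).
  exact: quintic_singular_dvd_disc.
by apply: contra pNg; rewrite !dvdz_gcd !(prime_dvdzM, prime_dvdzX) // !orbb.
Qed.

Theorem theorem3p1 (a b : int) (theta : algC) :
  irreducible_in_Zx (quintic a b) ->
  root (map_poly intr (quintic a b)) theta ->
  squarefree `|((2 ^+ 8 * a ^+ 5 + 5 ^+ 5 * b ^+ 4)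
                 %/ gcdz (2 ^+ 8 * a ^+ 5) (5 ^+ 5 * b ^+ 4))%Z|%N ->
  (Ztheta_is_ring_of_integers theta <->
   forall p : nat, prime p -> (p%:Z %| gcdz (2 * a) (5 * b))%Z -> cond_at a b p).
Proof.
move=> irr /rootP f_theta sqf.
have min_f := irreducible_monic_minCpoly irr (quintic_monic a b) f_theta.
have maximal_iff p (p_pr : prime p) := Ztheta_maximal_at_nonsingular min_f p_pr
  (fun P => quintic_multiple_factor_root p_pr).
apply: (iff_trans (Ztheta_maximal_local (minCpoly_int_Aint min_f))).
split=> [max p p_pr p_gcd|cond p p_pr].
  exact/quintic_nonsingular_cond_at/maximal_iff/max.
apply/maximal_iff=> //.
have [p_gcd|pNgcd] := boolP (p%:Z %| gcdz (2 * a) (5 * b))%Z.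
  exact/quintic_nonsingular_cond_at/cond.
exact: quintic_nonsingular_disc_squarefree.
Qed.
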